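(* Let $S$ be a right modular groupoid with a left identity element $l$, and let $T$ be a groupoid. Then $S\cong T$ (as groupoids) if and only if $[S]\cong[T]$.
   Context: A groupoid is a set with a binary operation, written as juxtaposition. A groupoid is right modular if $(xy)z=(zy)x$ for all $x,y,z$. A left identity is an element $l$ with $lx=x$ for all $x$. For a groupoid $S$, $[S]$ denotes the set $S$ with its natural ternary operation $[abc]=(ab)c$. For groupoids $S,T$, $[S]\cong[T]$ means that there is a bijection $\delta:S\to T$ with $\delta[abc]=[(\delta a)(\delta b)(\delta c)]$ for all $a,b,c\in S$. *)

(* Defs.v *)
From mathcomp Require Import all_boot.

Set Implicit Arguments.
Unset Strict Implicit.
Unset Printing Implicit Defensive.

Local Open Scope group_scope.

(* A groupoid is a [magmaType]: the class only provides [*], with no axiom and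
   no equality or choice structure on the carrier. *)
Definition right_modular (S : magmaType) : Prop :=
  forall x y z : S, (x * y) * z = (z * y) * x.

Definition groupoid_isomorphic (S T : magmaType) : Prop :=
  exists2 f : S -> T, bijective f & {morph f : x y / x * y}.

Definition ternary (S : magmaType) (a b c : S) : S := (a * b) * c.

Definition ternary_isomorphic (S T : magmaType) : Prop :=
  exists2 delta : S -> T, bijective delta &
    forall a b c : S,
      delta (ternary a b c) = ternary (delta a) (delta b) (delta c).

(* Main.v *)
(** Let [delta] be an isomorphism of the ternary structures, [m := delta l] and
    [delta e := m * m].  Then [m * m] is a left identity of [T], so
    [delta b * delta c = delta ((e * b) * c)]: the product of [T] is that of [S]
    twisted by [e].  Moreover [(e * e) * c = c], hence left multiplication by
    [e * l] is invertible with inverse left multiplication by [e], and it undoes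
    the twist: [x |-> delta ((e * l) * x) = m * delta x] is an isomorphism. *)
Require Import Defs.
From mathcomp Require Import all_boot.

Local Open Scope group_scope.

Lemma right_modular_medial (S : magmaType) (a b c d : S) :
  right_modular S -> (a * b) * (c * d) = (a * c) * (b * d).
Proof. by move=> rmod; rewrite (rmod a b) (rmod c d b) (rmod (b * d) c a). Qed.

(** Left multiplications commute: with [l] put before [a] and before [b], this is the medial law. *)
Lemma right_modular_mulCA (S : magmaType) (l a b c : S) :
    right_modular S -> (forall x : S, l * x = x) ->
  a * (b * c) = b * (a * c).
Proof.
move=> rmod mul1; rewrite -{1}(mul1 a) -{2}(mul1 b).
exact: right_modular_medial.
Qed.

(** Right modularity and [l] give [(e * l) * (e * x) = (x * e) * e = (e * e) * x]. *)
Lemma right_modular_mulK (S : magmaType) (l e : S) :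
    right_modular S -> (forall x : S, l * x = x) ->
    (forall x : S, (e * e) * x = x) ->
  forall x : S, (e * l) * (e * x) = x.
Proof.
move=> rmod mul1 mulee x.
by rewrite (rmod e l (e * x)) (rmod e x l) mul1 (rmod x e e) mulee.
Qed.

Lemma groupoid_isomorphic_ternary (S T : magmaType) :
  groupoid_isomorphic S T -> ternary_isomorphic S T.
Proof.
by case=> f f_bij fM; exists f => // a b c; rewrite /ternary !fM.
Qed.

Lemma ternary_isomorphic_groupoid (S T : magmaType) (l : S) :
    right_modular S -> (forall x : S, l * x = x) ->
  ternary_isomorphic S T -> groupoid_isomorphic S T.
Proof.
move=> rmod mul1 [delta [gamma deltaK gammaK] deltaT].
pose m := delta l; pose e := gamma (m * m).
have delta_e : delta e = m * m by exact: gammaK.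
(* This is the image under [delta] of [(l * l) * x = x]. *)
have mul_delta_e x : delta e * delta x = delta x.
  by rewrite delta_e -[LHS]deltaT /ternary !mul1.
have mul_delta x y : delta x * delta y = delta ((e * x) * y).
  by rewrite -{1}(mul_delta_e x) -[LHS]deltaT.
have mulee x : (e * e) * x = x.
  by apply: (can_inj deltaK); rewrite -mul_delta mul_delta_e.
have mulCA a b c := right_modular_mulCA S l a b c rmod mul1.
have mulelK := right_modular_mulK S l e rmod mul1 mulee.
have mulKel x : e * ((e * l) * x) = x by rewrite mulCA mulelK.
exists (fun x => delta ((e * l) * x)); last first.
  (* The twist by [e] cancels [e * l] on the first factor; the [e * l] on the second commutes past
     [x]. *)
  by move=> x y; rewrite mul_delta mulKel mulCA.
by exists (fun y => e * gamma y) => x; rewrite ?deltaK ?mulKel // mulelK gammaK.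
Qed.

Theorem theorem46 (S T : magmaType) (l : S)
    (S_rmod : right_modular S) (l_left_id : forall x : S, l * x = x) :
  groupoid_isomorphic S T <-> ternary_isomorphic S T.
Proof.
split; first exact: groupoid_isomorphic_ternary.
exact: (ternary_isomorphic_groupoid S T l).
Qed.
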